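(* Let $p\ge 2$, let $\hat\tau=[-1,1]^2$, and let $\hat\pi_p,\hat I_p:C(\hat\tau)\to\mathcal{Q}_p(\hat\tau)$ be the vertex-edge-cell interpolation operator and the Gauss-Lobatto (Lagrange) interpolation operator of degree $p$ on $\hat\tau$. Let $\hat\pi_{p+1}:C(\hat\tau)\to\mathcal{Q}_{p+1}(\hat\tau)$ be the vertex-edge-cell interpolation operator of degree $p+1$. Then $$\hat\pi_p=\hat I_p\,\hat\pi_{p+1}.$$ Moreover, let $\hat I_{p+1}^*:C(\hat\tau)\to\mathcal{Q}_{p+1}(\hat\tau)$ be the Lagrange interpolation operator with interpolation nodes $(t_i^*,t_j^* )$, $i,j=0,\dots,p+1$, where $\{t_i^*\}_{i=0}^{p+1}$ consists of the $p+1$ Gauss-Lobatto nodes $t_0,\dots,t_p$ plus one arbitrary further node $t_{p+1}^*\in(-1,1)$, distinct from $t_0,\dots,t_p$. Then $$\hat I_p=\hat\pi_p\,\hat I_{p+1}^*.$$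
   Context: $\mathcal{P}_m$ denotes polynomials of degree at most $m$ in one variable; $\mathcal{Q}_m$ denotes polynomials in two variables of degree at most $m$ in each variable. Vertex-edge-cell operator. For a degree $m\ge2$, $\hat\pi_m:C(\hat\tau)\to\mathcal{Q}_m(\hat\tau)$ is defined by: $(\hat\pi_m\hat v-\hat v)(\hat a_i)=0$ for $i=1,\dots,4$; $\int_{\hat e_i}(\hat\pi_m\hat v-\hat v)\hat q=0$ for $i=1,\dots,4$ and all $\hat q\in\mathcal{P}_{m-2}(\hat e_i)$; $\iint_{\hat\tau}(\hat\pi_m\hat v-\hat v)\hat q=0$ for all $\hat q\in\mathcal{Q}_{m-2}(\hat\tau)$. Here $\hat a_i$ are the vertices and $\hat e_i$ the edges of $\hat\tau=[-1,1]^2$. Gauss-Lobatto operator. Let $-1=t_0<t_1<\dots<t_p=1$ be the zeros of $(1-t^2)L_p'(t)$ on $[-1,1]$, where $L_p$ is the Legendre polynomial of degree $p$ (the Gauss-Lobatto nodes). The operator $\hat I_p:C(\hat\tau)\to\mathcal{Q}_p(\hat\tau)$ is defined by $(\hat I_p\hat v)(t_i,t_j)=\hat v(t_i,t_j)$, $i,j=0,\dots,p$. Products of operators denote composition. *)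

(* Defs.v *)
From HB Require Import structures.
From mathcomp Require Import all_boot all_order all_algebra.
From mathcomp Require Import all_classical all_reals all_analysis.

Set Implicit Arguments.
Unset Strict Implicit.
Unset Printing Implicit Defensive.

Import Order.TTheory GRing.Theory Num.Theory.
Import numFieldNormedType.Exports.

Local Open Scope classical_set_scope.
Local Open Scope ring_scope.

Section Interpolation.
Context {R : realType}.
Implicit Types (m n p : nat) (v : R * R -> R).

Definition ref_square : set (R * R) := `[-1, 1] `*` `[-1, 1].

(** Elements of C(ref_square) are represented by total functions on the plane
    whose restriction to the square is continuous; the operators below only
    look at the values on the square. *)
Definition continuous_on_square v : Prop :=
  {within ref_square, continuous v}.

Definition Ppoly m : set {poly R} := [set q : {poly R} | (size q <= m.+1)%N].

(** Bivariate polynomials are polynomials in 'X with coefficients polynomials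
    in 'Y; a [size] is a degree plus one. *)
Definition Qpoly m : set {poly {poly R}} :=
  [set w : {poly {poly R}} | (size w <= m.+1)%N /\ (sizeY w <= m.+1)%N].

Definition poly_fun (w : {poly {poly R}}) : R * R -> R :=
  fun z => w.[z.1, z.2].

(** The three groups of conditions are those at the vertices (a, b), on the
    edges [-1, 1] x {c} and {c} x [-1, 1], and on the cell.  The degree m - 2
    is meant for m >= 2. *)
Definition vec_interpolant m v : set {poly {poly R}} :=
  [set w : {poly {poly R}} | [/\ Qpoly m w,
    forall a b, a \in [:: -1; 1] -> b \in [:: -1; 1] ->
      poly_fun w (a, b) - v (a, b) = 0,
    forall c, c \in [:: -1; 1] -> forall q, Ppoly (m - 2) q ->
      \int[lebesgue_measure]_(s in `[-1, 1])
        ((poly_fun w (s, c) - v (s, c)) * q.[s]) = 0 /\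
      \int[lebesgue_measure]_(s in `[-1, 1])
        ((poly_fun w (c, s) - v (c, s)) * q.[s]) = 0 &
    forall q, Qpoly (m - 2) q ->
      \int[(lebesgue_measure \x lebesgue_measure)%E]_(z in ref_square)
        ((poly_fun w z - v z) * poly_fun q z) = 0]].

(** The value 0 is a dummy, for data that have no interpolant. *)
Definition vec_interp m v : {poly {poly R}} := xget 0 (vec_interpolant m v).

Definition lagrange_interpolant n (t : n.+1.-tuple R) v :
    set {poly {poly R}} :=
  [set w : {poly {poly R}} | Qpoly n w /\
    forall i j : 'I_n.+1,
      poly_fun w (tnth t i, tnth t j) = v (tnth t i, tnth t j)].

(** Tensor-product Lagrange interpolation at the nodes (t_i, t_j); again 0 is a
    dummy, for families of nodes with repetitions. *)
Definition lagrange_interp n (t : n.+1.-tuple R) v : {poly {poly R}} :=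
  xget 0 (lagrange_interpolant t v).

(** Rodrigues' formula. *)
Definition legendre p : {poly R} :=
  ((2 ^ p * p`!)%N%:R)^-1 *: (('X^2 - 1) ^+ p)^`(p).

Definition gauss_lobatto_nodes p (t : p.+1.-tuple R) : Prop :=
  [/\ tnth t ord0 = -1,
      tnth t ord_max = 1,
      forall i j : 'I_p.+1, (i < j)%N -> tnth t i < tnth t j &
      forall x : R, x \in t <->
        -1 <= x <= 1 /\ root ((1 - 'X^2) * (legendre p)^`()) x].

End Interpolation.

(* Main.v *)
From HB Require Import structures.
Require Import Defs.
From mathcomp Require Import all_boot all_order all_algebra.
From mathcomp Require Import all_classical all_reals all_analysis.
From mathcomp Require Import zify ring measurable_realfun.
Import Order.TTheory GRing.Theory Num.Theory.
Import numFieldNormedType.Exports.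
Local Open Scope ring_scope.

Set Implicit Arguments.
Unset Strict Implicit.
Unset Printing Implicit Defensive.

(** Order the degrees of freedom of the vertex-edge-cell operator in one
    variable as a single sequence: the values at -1 and at 1, then the moments
    against 1, x, x^2, ...  The degrees of freedom of degree m are the first
    m + 1 of them, so those of degree p are among those of degree p + 1.  In two
    variables the defining conditions of [vec_interpolant m v] say exactly that
    w has the same tensor products of these functionals as v, for all pairs of
    indices up to m ([vec_interpolantP]; Fubini turns the cell integrals into
    iterated ones).

    Both identities come down to one fact.  On polynomials of degree at most
    p + 1, each of the first p + 1 functionals is a combination of the values at
    the Gauss-Lobatto nodes ([gauss_lobatto_quadrature]).  Indeed a polynomial
    of that degree which vanishes at the nodes is a multiple of
    (1 - x^2) L_p'(x); this vanishes at -1 and 1, and integrating by parts moves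
    the derivative away from L_p, whose orthogonality to degrees below p shows
    that (1 - x^2) L_p' is orthogonal to degrees at most p - 2.  Applying this
    in each variable, two elements of Q_(p+1) that agree at the tensor nodes
    have the same vertex-edge-cell data of degree p ([tensor_node_quadrature]).

    For the first identity, take w to be the interpolant of v of degree p + 1
    and u its Lagrange interpolant: u and w agree at the nodes, so u has the
    data of degree p of w, which are those of v.  For the second, the Lagrange
    interpolants of v on the nodes t_i and on the enlarged family agree at the
    nodes t_i, so they have the same data of degree p.

    Both arguments conclude with existence and uniqueness of interpolants.  For
    tensor data these follow from unisolvence in one variable
    ([tensor_exists], [tensor_unique]); the vertex-edge-cell functionals are
    unisolvent because a polynomial in their kernel is (1 - x^2) q with
    the integral of (1 - x^2) q^2 equal to 0 ([poly_node_unisolvent]). *)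

(** * Continuous functions on the square *)

Section SquareAnalysis.
Local Open Scope classical_set_scope.
Context {R : realType}.
Implicit Types (v g : R * R -> R) (f : {poly R}) (w : {poly {poly R}}).

Notation mu := (@lebesgue_measure R).

Let seg_measurable : measurable (`[-1, 1] : set R).
Proof. exact: measurable_itv. Qed.

(** The plane carries the product sigma-algebra rather than that of the
    open sets; an open set belongs to it as the union of the countably many
    squares with rational centre and radius 1/(n+1) that it contains. *)
Lemma open_measurable_plane (U : set (R * R)) :
  open U -> measurable (U : set (measurableTypeR R * measurableTypeR R)).
Proof.
move=> oU.
pose box (i : rat * rat * nat) : set (R * R) :=
  ball (ratr i.1.1 : R) (i.2.+1%:R^-1) `*` ball (ratr i.1.2 : R) (i.2.+1%:R^-1).
(* The boxes not contained in U are replaced by the empty set, so that the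
   union ranges over a fixed countable type. *)
have -> : U = \bigcup_i (if `[< box i `<=` U >] then box i else set0).
  apply/seteqP; split=> [z Uz|z [i _]]; last first.
    by case: asboolP => // + iz; exact.
  have /nbhs_ballP[e /= e0 eU] := open_nbhs_nbhs (conj oU Uz).
  have [n ne] : exists n : nat, n.+1%:R^-1 + n.+1%:R^-1 < e.
    have [n _ /(_ n (leqnn n))] :=
      near_infty_natSinv_lt (PosNum (divr_gt0 e0 (ltr0n R 2))).
    by move=> /= H; exists n; rewrite (splitr e) ltrD.
  have dr (x : R) : exists q : rat, ball x n.+1%:R^-1 (ratr q).
    have n0 : 0 < n.+1%:R^-1 :> R by rewrite invr_gt0.
    have [|y [xy [q _ qy]]] :=
      @dense_rat R (ball x n.+1%:R^-1) _ (@ball_open R R^o x _).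
      by exists x; apply: ballxx.
    by exists q; rewrite qy.
  have [[q1 h1] [q2 h2]] := (dr z.1, dr z.2).
  exists (q1, q2, n) => //; rewrite asboolT.
    by split => /=; exact: ball_sym.
  move=> y [/= y1 y2]; apply: eU; split => /=; apply: (le_ball (ltW ne)).
    exact: ball_triangle h1 y1.
  exact: ball_triangle h2 y2.
apply: countable_bigcupT_measurable => // i; case: ifP => // _.
by apply: measurableX; apply: open_measurable; apply: (@ball_open R R^o).
Qed.

Lemma continuous_square_measurable v :
  continuous_on_square v ->
  measurable_fun (ref_square : set (measurableTypeR R * measurableTypeR R)) v.
Proof.
move=> /continuousP cv mS.
apply: (measurability _ (RGenOpens.measurableE R)) => // _ [_ [a [b ->] <-]].
have /open_subspaceP[V oV VS] :=
  cv _ (@interval_open R (BRight a) (BLeft b) isT isT).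
rewrite (_ : _ `&` _ = V `&` ref_square); last by rewrite VS setIC.
by apply: measurableI => //; exact: open_measurable_plane.
Qed.

Lemma ref_square_measurable :
  measurable (ref_square : set (measurableTypeR R * measurableTypeR R)).
Proof. exact: measurableX. Qed.

Lemma continuous_square_integrable v :
  continuous_on_square v ->
  (mu \x mu)%E.-integrable ref_square (EFin \o v).
Proof.
move=> cv; apply: measurable_bounded_integrable.
- exact: ref_square_measurable.
- have S2 := product_measure1E mu mu seg_measurable seg_measurable.
  have I2 : (mu `[(-1)%R, 1%R] * mu `[(-1)%R, 1%R] < +oo)%E.
    by rewrite lebesgue_measure_itv/= lte_fin gtrN// -EFinB -EFinM ltry.
  exact: (eq_ind_r (fun x => x < +oo)%E I2 S2).
- exact: continuous_square_measurable.
- have cS : compact (@ref_square R).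
    by apply: compact_setX; exact: segment_compact.
  have /compact_bounded[M [_ mrt]] := continuous_compact cv cS.
  by exists M; split; rewrite ?num_real // => ? ? ? ?; exact: mrt.
Qed.

(** Continuity within the square passes to every curve that stays in it; it is
    used for the horizontal and vertical segments. *)
Lemma continuous_section v (h : R -> R * R) :
  continuous_on_square v -> continuous h ->
  (forall x, `[-1, 1] x -> ref_square (h x)) ->
  {within `[-1, 1], continuous (v \o h)}.
Proof.
move=> /subspace_continuousP cv ch hS.
apply/subspace_continuousP => x xI.
apply: cvg_comp (cv _ (hS _ xI)) => B /= /(ch x).
by apply: (@filterS _ (nbhs x)) => y /= By yI; exact/By/hS.
Qed.

Lemma section_continuous v x : continuous_on_square v -> `[-1, 1] x ->
  {within `[-1, 1], continuous (fun y => v (x, y))}.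
Proof.
move=> cv xI; apply: (@continuous_section v (fun y => (x, y))) => //.
by move=> y; exact: (cvg_pair (cvg_cst x) cvg_id).
Qed.

Lemma section_continuous_swap v y : continuous_on_square v -> `[-1, 1] y ->
  {within `[-1, 1], continuous (fun x => v (x, y))}.
Proof.
move=> cv yI; apply: (@continuous_section v (fun x => (x, y))) => //.
by move=> x; exact: (cvg_pair cvg_id (cvg_cst y)).
Qed.

Lemma fubini_square v :
  continuous_on_square v ->
  \int[(mu \x mu)%E]_(z in ref_square) v z =
  \int[mu]_(x in `[-1, 1]) \int[mu]_(y in `[-1, 1]) v (x, y).
Proof.
move=> cv; rewrite /Rintegral; congr fine.
have iv := continuous_square_integrable cv.
rewrite integral_mkcond -integral12_prod_meas1; last first.
  by apply/(integrable_restrict _ ref_square_measurable); rewrite ?setTI.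
rewrite [RHS]integral_mkcond; apply: eq_integral => x _.
rewrite /fubini_F patchE; case: ifPn => xI; last first.
  apply: integral0_eq => y _; rewrite patchE memNset//= => -[/= xI' _].
  by move/negP: xI; apply; rewrite inE.
have cvx : {within `[-1, 1], continuous (fun y => v (x, y))}.
  by apply: section_continuous => //; rewrite inE in xI.
rewrite fineK; last first.
  apply: integrable_fin_num => //.
  exact: (continuous_compact_integrable (@segment_compact R (-1) 1) cvx).
rewrite [RHS]integral_mkcond; apply: eq_integral => y _; rewrite !patchE.
by rewrite /ref_square in_setX xI.
Qed.

Lemma continuous_poly_fun w : continuous (poly_fun w).
Proof.
elim/poly_ind: w => [|u c IH] z.
  rewrite (_ : poly_fun _ = cst 0); first exact: cvg_cst.
  by apply/funext => ?; rewrite /poly_fun !horner0.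
rewrite (_ : poly_fun _ = (fun z => poly_fun u z * z.1 + c.[z.2])); last first.
  by apply/funext => ?; rewrite /poly_fun !hornerE.
apply: cvgD; last first.
  apply: (cvg_comp (@snd R R) (horner c)); first exact: cvg_snd.
  exact: continuous_horner.
by apply: cvgM; [exact: IH|exact: cvg_fst].
Qed.

End SquareAnalysis.

(** * Integrals of polynomials over the segment *)

Section SegmentIntegral.
Context {R : realType}.
Implicit Types (f g q : {poly R}).
Notation mu := (@lebesgue_measure R).

Definition integral_poly f : R := \int[mu]_(x in `[-1, 1]) f.[x].

Lemma poly_integrable f :
  mu.-integrable `[-1, 1]%classic (EFin \o horner f).
Proof.
apply: continuous_compact_integrable; first exact: segment_compact.
by apply: continuous_subspaceT; exact: continuous_horner.
Qed.

Lemma integral_poly_is_linear : scalar integral_poly.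
Proof.
move=> a f g; rewrite /integral_poly.
under eq_Rintegral do rewrite hornerD hornerZ.
rewrite RintegralD//; first last.
- exact: poly_integrable.
- rewrite (_ : _ \o _ = EFin \o horner (a *: f)); first exact: poly_integrable.
  by apply/funext => x /=; rewrite hornerZ.
by rewrite RintegralZl//; exact: poly_integrable.
Qed.

HB.instance Definition _ :=
  GRing.isLinear.Build R {poly R} R _ integral_poly integral_poly_is_linear.

Lemma integral_poly_deriv f : integral_poly f^`() = f.[1] - f.[-1].
Proof.
rewrite /integral_poly /Rintegral (@continuous_FTC2 _ _ (horner f)) ?gtrN//.
- by apply: continuous_subspaceT; exact: continuous_horner.
- split; first by move=> x _; exact: derivable_horner.
    by apply: cvg_at_right_filter; exact: continuous_horner.
  by apply: cvg_at_left_filter; exact: continuous_horner.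
- by move=> x _; rewrite derivE.
Qed.

Lemma integral_poly_by_parts f g :
  integral_poly (f^`() * g) =
  f.[1] * g.[1] - f.[-1] * g.[-1] - integral_poly (f * g^`()).
Proof.
by rewrite -!hornerM -integral_poly_deriv derivM linearD /= addrK.
Qed.

Lemma poly_antiderivative f : exists F, F^`() = f.
Proof.
exists (\poly_(i < (size f).+1) (f`_i.-1 / i%:R)); apply/polyP => i.
rewrite coef_deriv coef_poly ltnS; case: ltnP => [_|/leq_sizeP ->//].
  by rewrite /= -[LHS]mulr_natr divfK// pnatr_eq0.
by rewrite mul0rn.
Qed.

(** The segment is infinite: the points 1/(k+1) already give more roots of
    f - c than its degree allows. *)
Lemma poly_constant_on_segment f c :
  (forall x, -1 <= x <= 1 -> f.[x] = c) -> f = c%:P.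
Proof.
move=> fc; apply/eqP; rewrite -subr_eq0; apply/eqP.
pose s := [seq k.+1%:R^-1 : R | k <- iota 0 (size (f - c%:P))].
apply: (@roots_geq_poly_eq0 _ _ s); last by rewrite size_map size_iota.
  apply/allP => _ /mapP[k _ ->]; rewrite /root !hornerE fc ?subrr//.
  by rewrite (@le_trans _ _ 0) ?invr_ge0//= invf_le1// ler1n.
rewrite map_inj_uniq ?iota_uniq// => i j /invr_inj /eqP.
by rewrite eqr_nat => /eqP[].
Qed.

(** An antiderivative of f is nondecreasing on the segment and takes the same
    value at both ends, so it is constant there. *)
Lemma integral_poly_eq0 f :
  (forall x, -1 <= x <= 1 -> 0 <= f.[x]) -> integral_poly f = 0 -> f = 0.
Proof.
have [F <-] := poly_antiderivative f => F'_ge0.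
rewrite integral_poly_deriv => /eqP; rewrite subr_eq0 => /eqP F1.
have Fle x y : -1 <= x -> x <= y -> y <= 1 -> F.[x] <= F.[y].
  apply: ger0_derive1_ndecr.
  - by move=> z _; exact: derivable_horner.
  - move=> z; rewrite in_itv/= => /andP[z0 z1].
    by rewrite -derivE F'_ge0// (ltW z0) (ltW z1).
  - by apply: continuous_subspaceT; exact: continuous_horner.
rewrite (@poly_constant_on_segment F F.[1]) ?derivC// => x /andP[x0 x1].
by apply/le_anti; rewrite [X in _ && (X <= _)]F1 !Fle.
Qed.

End SegmentIntegral.

(** * Orthogonality of Legendre and Lobatto polynomials *)

Section LegendreOrthogonality.
Context {R : realType}.
Implicit Types (f g q : {poly R}) (p k m : nat).

Lemma size_deriv_leq f : (size f^`() <= (size f).-1)%N.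
Proof.
have [->|f0] := eqVneq f 0; first by rewrite deriv0 size_poly0.
by rewrite -ltnS prednK ?lt_size_deriv// size_poly_gt0.
Qed.

Lemma dvdp_exp_derivn f (a : R) k m :
  ('X - a%:P) ^+ (k + m) %| f -> ('X - a%:P) ^+ m %| f^`(k).
Proof.
elim: k m => [|k IH] m; first by rewrite add0n.
rewrite addSnnS => /IH /dvdpP[g fk]; rewrite derivnS fk derivM.
rewrite deriv_exp derivXsubC mul1r -mulr_natl /=.
by rewrite dvdp_add ?dvdp_mull// exprS dvdp_mull.
Qed.

Lemma rodrigues_root p k (a : R) : (k < p)%N -> a ^+ 2 = 1 ->
  ((('X^2 - 1) ^+ p)^`(k)).[a] = 0.
Proof.
move=> kp a2; apply/eqP; rewrite -/(root _ _) -dvdp_XsubCl.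
rewrite -[X in X %| _]expr1; apply: dvdp_exp_derivn.
have : 'X - a%:P %| ('X^2 - 1 : {poly R}).
  by rewrite dvdp_XsubCl /root !hornerE a2 subrr.
move=> /(dvdp_exp2r p); apply: dvdp_trans.
by rewrite dvdp_exp2l// addn1.
Qed.

(** Repeated integration by parts lowers the order k of the derivative together
    with the degree of q; the boundary terms vanish because 1 and -1 are zeros
    of multiplicity p of (x^2 - 1)^p. *)
Lemma rodrigues_orthogonal p k q : (k <= p)%N -> (size q <= k)%N ->
  integral_poly ((('X^2 - 1) ^+ p)^`(k) * q) = 0.
Proof.
elim: k q => [|k IH] q kp sq.
  by move: sq; rewrite leqn0 size_poly_eq0 => /eqP ->; rewrite mulr0 linear0.
rewrite derivnS integral_poly_by_parts IH ?(ltnW kp)//.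
  by rewrite !rodrigues_root// ?sqrrN ?expr1n// !mul0r !subr0.
by have := size_deriv_leq q; lia.
Qed.

Lemma legendre_orthogonal p q : (size q <= p)%N ->
  integral_poly (legendre p * q) = 0.
Proof.
move=> sq; rewrite /legendre -scalerAl linearZ /=.
by rewrite rodrigues_orthogonal ?mulr0.
Qed.

(** Differentiating p times keeps the leading coefficient of (x^2 - 1)^p away
    from 0 in characteristic 0. *)
Lemma size_legendre p : size (@legendre R p) = p.+1.
Proof.
have lp : lead_coef ('X^2 - 1 : {poly R}) = 1.
  by rewrite lead_coefDl ?lead_coefXn// size_polyN size_poly1 size_polyXn.
have sp : size ('X^2 - 1 : {poly R}) = 3%N.
  by rewrite size_polyDl ?size_polyXn// size_polyN size_poly1.
(* The leading term has degree p + p, hence index p after p derivatives. *)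
have lg : (('X^2 - 1 : {poly R}) ^+ p) `_ (p + p) = 1.
  have <- : lead_coef (('X^2 - 1 : {poly R}) ^+ p) = 1.
    by rewrite lead_coef_exp lp expr1n.
  by rewrite lead_coefE size_exp sp mul2n -addnn.
rewrite /legendre size_scale; last first.
  by rewrite invr_eq0 pnatr_eq0 -lt0n muln_gt0 expn_gt0 fact_gt0.
apply/eqP; rewrite eqn_leq; apply/andP; split.
  apply/leq_sizeP => j pj; rewrite coef_derivn nth_default ?mul0rn//.
  rewrite -ltnS (leq_trans _ (_ : (p + p).+1 < _)%N)//.
    have := size_exp ('X^2 - 1 : {poly R}) p.
    by rewrite sp mul2n -addnn; case: (size _) => //= n ->.
  by rewrite ltnS -addnS leq_add2l.
rewrite ltnNge; apply/negP => /leq_sizeP /(_ p (leqnn p)).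
rewrite coef_derivn lg => /eqP; rewrite pnatr_eq0.
by rewrite eqn0Ngt ffact_gt0 leq_addr.
Qed.

(** The polynomial whose zeros are the Gauss-Lobatto nodes. *)
Definition lobatto p : {poly R} := (1 - 'X^2) * (legendre p)^`().

Let size_1subX2 : size (1 - 'X^2 : {poly R}) = 3%N.
Proof. by rewrite addrC size_polyDl size_polyN size_polyXn// size_poly1. Qed.

Lemma size_lobatto p : (size (lobatto p) <= p.+2)%N.
Proof.
rewrite (leq_trans (size_polyMleq _ _))// size_1subX2 !ltnS.
by rewrite (leq_trans (size_deriv_leq _))// size_legendre.
Qed.

Lemma lobatto_neq0 p : (0 < p)%N -> lobatto p != 0.
Proof.
move=> p0; rewrite mulf_neq0 -?size_poly_eq0 ?size_1subX2// size_poly_eq0.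
apply/eqP => /(congr1 (fun f : {poly R} => f`_p.-1)).
rewrite coef_deriv prednK// coef0.
have -> : (legendre p)`_p = lead_coef (@legendre R p).
  by rewrite lead_coefE size_legendre.
move/eqP; rewrite mulrn_eq0 gtn_eqF//= lead_coef_eq0.
by rewrite -size_poly_eq0 size_legendre.
Qed.

(** Since (1 - x^2) q vanishes at both ends, integrating by parts leaves the
    integral of L_p against ((1 - x^2) q)', which has degree below p. *)
Lemma lobatto_orthogonal p q : (size q <= p.-1)%N ->
  integral_poly (lobatto p * q) = 0.
Proof.
move=> sq; set r := (1 - 'X^2) * q.
have -> : lobatto p * q = (legendre p)^`() * r.
  by rewrite /lobatto /r mulrCA mulrA.
have r0 a : a ^+ 2 = 1 -> r.[a] = 0.
  by move=> a2; rewrite /r !hornerE a2 subrr mul0r.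
rewrite integral_poly_by_parts !r0 ?sqrrN ?expr1n// !mulr0 !subr0 sub0r.
rewrite legendre_orthogonal ?oppr0//.
rewrite (leq_trans (size_deriv_leq _))//.
have [q0|q0] := eqVneq q 0; first by rewrite /r q0 mulr0 size_poly0.
have sq0 : (0 < size q)%N by rewrite size_poly_gt0.
have := size_polyMleq (1 - 'X^2) q; rewrite -/r size_1subX2.
by move: sq sq0; move: (size q) (size r) => a b; lia.
Qed.

End LegendreOrthogonality.

(** * Unisolvent families and their tensor products *)

Section TensorInterpolation.
Context {R : realType}.
Implicit Types (f : {poly R}) (w : {poly {poly R}}) (L M : {scalar {poly R}}).

Definition unisolvent n (L : 'I_n.+1 -> {scalar {poly R}}) : Prop :=
  forall f, (size f <= n.+1)%N -> (forall i, L i f = 0) -> f = 0.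

(** Unisolvence says that the square matrix of the values L_i(x^k) has trivial
    kernel; the rows of its inverse are the coefficients of the dual basis. *)
Lemma unisolvent_dual_basis n (L : 'I_n.+1 -> {scalar {poly R}}) :
  unisolvent L ->
  exists phi : 'I_n.+1 -> {poly R}, forall j,
    (size (phi j) <= n.+1)%N /\ forall i, L i (phi j) = (j == i)%:R.
Proof.
move=> Lu; pose A : 'M[R]_n.+1 := \matrix_(k, i) L i 'X^k.
have LA (c : 'rV_n.+1) i : L i (rVpoly c) = (c *m A) 0 i.
  rewrite /rVpoly poly_def linear_sum mxE; apply: eq_bigr => k _ /=.
  by rewrite linearZ /= mxE valK.
have uA : A \in unitmx.
  rewrite -row_free_unit -kermx_eq0; apply/rowV0P => c /sub_kermxP cA.
  rewrite -[c]rVpolyK (Lu (rVpoly c)) ?linear0// ?size_poly// => i.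
  by rewrite LA cA mxE.
exists (fun j => rVpoly (row j (invmx A))) => j; split; first exact: size_poly.
by move=> i; rewrite LA -row_mul mulVmx// !mxE.
Qed.

Lemma sizeY_leqP w n :
  reflect (forall i, (size (w`_i)%R <= n)%N) (sizeY w <= n)%N.
Proof.
apply: (iffP idP) => [wn i|wn]; last by apply/bigmax_leqP.
exact: leq_trans (max_size_coefXY _ _) wn.
Qed.

(** The tensor product of two functionals: [M] acts on the second variable,
    that of the coefficients of [w], and [L] on the first one. *)
Definition tensor (L M : {poly R} -> R) w : R := L (map_poly M w).

Lemma horner_map_linear M w x : (map_poly M w).[x] = M w.[x%:P].
Proof.
rewrite (@horner_coef_wide _ (size w)) ?size_poly// horner_coef linear_sum.
apply: eq_bigr => i _; rewrite coef_map -polyC_exp mulrC.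
by rewrite -linearZ /= [w`_i * _]mulrC mul_polyC.
Qed.

Lemma tensor_horner x y w :
  tensor (horner_eval x) (horner_eval y) w = poly_fun w (x, y).
Proof. exact: (horner_map_linear (horner_eval y)). Qed.

(** Unisolvence is used once in each variable: first for the polynomials
    [map_poly (L j) w], then for the coefficients of [w]. *)
Lemma tensor_unique n (L : 'I_n.+1 -> {scalar {poly R}}) w w' :
  unisolvent L -> Qpoly n w -> Qpoly n w' ->
  (forall i j, tensor (L i) (L j) w = tensor (L i) (L j) w') -> w = w'.
Proof.
move=> Lu [wX /sizeY_leqP wY] [wX' /sizeY_leqP wY'] ww'.
have E j : map_poly (L j) w = map_poly (L j) w'.
  apply/eqP; rewrite -subr_eq0; apply/eqP/Lu => [|i].
    rewrite (leq_trans (size_polyD _ _))// size_polyN geq_max.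
    by rewrite !(leq_trans (size_poly _ _)).
  by rewrite linearB; apply/eqP; rewrite subr_eq0; apply/eqP/ww'.
apply/polyP => a; apply/eqP; rewrite -subr_eq0; apply/eqP/Lu => [|j].
  by rewrite (leq_trans (size_polyD _ _))// size_polyN geq_max wY wY'.
by rewrite linearB -!(coef_map (L j)) E subrr.
Qed.

(** The interpolant is the sum of c_ij phi_i(x) phi_j(y) over the dual basis. *)
Lemma tensor_exists n (L : 'I_n.+1 -> {scalar {poly R}})
    (c : 'I_n.+1 -> 'I_n.+1 -> R) :
  unisolvent L ->
  exists w, Qpoly n w /\ forall i j, tensor (L i) (L j) w = c i j.
Proof.
move=> /unisolvent_dual_basis[phi phiP].
have sphi j := (phiP j).1; have Lphi j i : L i (phi j) = _ := (phiP j).2 i.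
pose g i := \sum_j c i j *: phi j.
have Lg i j : L j (g i) = c i j.
  rewrite linear_sum (bigD1 j)//= linearZ /= Lphi eqxx mulr1 big1 ?addr0//.
  by move=> k kj; rewrite linearZ /= Lphi (negbTE kj) mulr0.
pose w := \poly_(a < n.+1) (\sum_i (phi i)`_a *: g i).
have coef_w a : w`_a = \sum_i (phi i)`_a *: g i.
  rewrite coef_poly; case: ltnP => // na.
  by rewrite big1// => i _; rewrite nth_default ?scale0r// (leq_trans (sphi i)).
exists w; split.
  split; first exact: size_poly.
  apply/sizeY_leqP => a; rewrite coef_w.
  rewrite (leq_trans (size_sum _ _ _))//; apply/bigmax_leqP => i _.
  rewrite (leq_trans (size_scale_leq _ _))//.
  rewrite (leq_trans (size_sum _ _ _))//; apply/bigmax_leqP => j _.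
  by rewrite (leq_trans (size_scale_leq _ _)).
move=> i j; rewrite /tensor.
have -> : map_poly (L j) w = \sum_k c k j *: phi k.
  apply/polyP => a; rewrite coef_map /= coef_w linear_sum coef_sum.
  by apply: eq_bigr => k _; rewrite linearZ /= Lg coefZ mulrC.
rewrite linear_sum (bigD1 i)//= linearZ /= Lphi eqxx mulr1 big1 ?addr0//.
by move=> k ki; rewrite linearZ /= Lphi (negbTE ki) mulr0.
Qed.

Lemma lagrange_unisolvent n (t : n.+1.-tuple R) : uniq t ->
  unisolvent (fun i => horner_eval (tnth t i)).
Proof.
move=> tu f fn f0; apply: (@roots_geq_poly_eq0 _ _ t) => //; last first.
  by rewrite size_tuple.
by apply/allP => x /tnthP[i ->]; apply/eqP/f0.
Qed.

Lemma lagrange_interpP n (t : n.+1.-tuple R) (v : R * R -> R) : uniq t ->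
  lagrange_interpolant t v (lagrange_interp t v).
Proof.
move=> /lagrange_unisolvent tu; apply: xgetPex.
have [w [wQ wv]] := tensor_exists (fun i j => v (tnth t i, tnth t j)) tu.
by exists w; split=> // i j; rewrite -tensor_horner wv.
Qed.

Lemma roots_scale_prod f (rs : seq R) : uniq rs -> all (root f) rs ->
  (size f <= (size rs).+1)%N -> exists a, f = a *: \prod_(z <- rs) ('X - z%:P).
Proof.
rewrite -uniq_rootsE => urs frs sf.
have [q fq] := uniq_roots_prod_XsubC frs urs; exists q`_0.
have [q0|q0] := eqVneq q 0; first by rewrite fq q0 mul0r coef0 scale0r.
rewrite -mul_polyC -size1_polyC// -(leq_add2r (size rs)).
move: sf; rewrite fq size_mul ?size_prod_XsubC//; first by rewrite addnS.
by rewrite -size_poly_eq0 size_prod_XsubC.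
Qed.

Lemma roots_proportional f g (rs : seq R) : uniq rs ->
  all (root f) rs -> all (root g) rs ->
  (size f <= (size rs).+1)%N -> (size g <= (size rs).+1)%N -> g != 0 ->
  exists a, f = a *: g.
Proof.
move=> urs frs grs sf sg g0.
have [a ->] := roots_scale_prod urs frs sf.
have [b gb] := roots_scale_prod urs grs sg.
have b0 : b != 0 by apply: contraNneq g0 => b0; rewrite gb b0 scale0r.
by exists (a / b); rewrite gb scalerA divfK.
Qed.

End TensorInterpolation.

(** * The vertex-edge-cell functionals in one variable *)

Section NodeFunctionals.
Local Open Scope classical_set_scope.
Context {R : realType}.
Implicit Types (f q : {poly R}) (w : {poly {poly R}}) (v g : R * R -> R).
Notation mu := (@lebesgue_measure R).

(** One sequence of functionals serves all degrees: those of degree m are the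
    ones of index at most m. *)
Definition node_functional k (h : R -> R) : R :=
  match k with
  | 0 => h (-1)
  | 1 => h 1
  | k'.+2 => \int[mu]_(x in `[-1, 1]) (h x * x ^+ k')
  end.

Definition poly_node k f : R := node_functional k (horner f).

Lemma poly_node_moment k f :
  poly_node k.+2 f = integral_poly (f * 'X^k).
Proof. by apply: eq_Rintegral => x _; rewrite hornerM hornerXn. Qed.

Lemma poly_node_is_linear k : scalar (poly_node k).
Proof.
move=> a f h; case: k => [|[|k]]; rewrite ?poly_node_moment.
- by rewrite /poly_node /= hornerD hornerZ.
- by rewrite /poly_node /= hornerD hornerZ.
- by rewrite mulrDl -scalerAl linearP.
Qed.

HB.instance Definition _ k :=
  GRing.isLinear.Build R {poly R} R _ (poly_node k) (poly_node_is_linear k).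

(** [Phi] is a bare function, so that the lemma applies directly to integrals
    depending on a parameter. *)
Lemma scalar_span0 (Phi : {poly R} -> R) n q : scalar Phi ->
  (forall k, (k < n)%N -> Phi 'X^k = 0) -> (size q <= n)%N -> Phi q = 0.
Proof.
move=> PhiP PhiX sq.
have Phi0 : Phi 0 = 0.
  by have := PhiP (-1) 0 0; rewrite scaler0 addr0 mulN1r addNr.
rewrite -[q]coefK poly_def; apply: (big_ind (fun x => Phi x = 0)) => //.
  by move=> x y x0 y0; rewrite -[x]scale1r PhiP x0 y0 mulr0 addr0.
move=> i _; rewrite -[_ *: _]addr0 PhiP Phi0 addr0 PhiX ?mulr0//.
exact: leq_trans (ltn_ord i) sq.
Qed.

(** A polynomial f in the kernel vanishes at -1 and 1, so f = (x^2 - 1) q, and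
    its moments make it orthogonal to q; but - f q is nonnegative on the
    segment. *)
Lemma poly_node_unisolvent m : (0 < m)%N ->
  unisolvent (fun i : 'I_m.+1 => poly_node i).
Proof.
move=> m0 f sf fi.
have {}fi k : (k <= m)%N -> poly_node k f = 0.
  by move=> km; exact: (fi (Ordinal (km : (k < m.+1)%N))).
have urs : uniq_roots [:: -1; 1 : R].
  by rewrite uniq_rootsE /= inE lt_eqF// gtrN.
have [|q] := uniq_roots_prod_XsubC _ urs (p := f).
  by rewrite /= /root [f.[-1]](fi 0)// [f.[1]](fi 1%N)// eqxx.
set d := \prod_(z <- _) _ => fq.
have sd : size d = 3%N by rewrite /d size_prod_XsubC.
have sq : (size q <= m.-1)%N.
  have [->|q0] := eqVneq q 0; first by rewrite size_poly0.
  have d0 : d != 0 by rewrite -size_poly_eq0 sd.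
  by move: sf; rewrite fq size_mul// sd; move: (size q) => a; lia.
have fq0 : integral_poly (f * q) = 0.
  apply: (@scalar_span0 (fun r => integral_poly (f * r)) m.-1) => //.
    by move=> a r s; rewrite mulrDr -scalerAr linearP.
  by move=> k km; rewrite -poly_node_moment fi//; lia.
have : - (f * q) = 0.
  apply: integral_poly_eq0 => [x /andP[x0 x1]|]; last first.
    by rewrite linearN /= fq0 oppr0.
  rewrite fq mulrAC -mulrN hornerM hornerM -expr2 mulr_ge0 ?sqr_ge0//.
  have -> : (- d).[x] = (1 - x) * (1 + x).
    by rewrite /d !big_cons big_nil mulr1 hornerN hornerM !hornerXsubC; ring.
  by rewrite mulr_ge0 ?subr_ge0// -lerBlDl sub0r.
move/eqP; rewrite oppr_eq0 mulf_eq0 => /orP[/eqP//|/eqP q0].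
by rewrite fq q0 mul0r.
Qed.

Lemma poly_node_lobatto p k : (k <= p)%N -> poly_node k (lobatto p) = 0 :> R.
Proof.
case: k => [|[|k]] kp; last first.
- rewrite poly_node_moment lobatto_orthogonal// size_polyXn; lia.
- by rewrite /poly_node /= /lobatto !hornerE expr1n subrr mul0r.
- by rewrite /poly_node /= /lobatto !hornerE sqrrN expr1n subrr mul0r.
Qed.

Lemma gauss_lobatto_uniq p (t : p.+1.-tuple R) :
  gauss_lobatto_nodes t -> uniq t.
Proof.
case=> _ _ t_lt _; apply/tuple_uniqP => i j ij; apply/val_inj.
by case: (ltngtP i j) => // /t_lt; rewrite ij ltxx.
Qed.

(** The weights are the values of the functionals on the Lagrange basis [phi].
    This gives equality in degree p; in degree p + 1 the error of Lagrange
    interpolation is a multiple of the Lobatto polynomial, which all the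
    functionals of index at most p annihilate. *)
Lemma gauss_lobatto_quadrature p (t : p.+1.-tuple R) :
  (0 < p)%N -> gauss_lobatto_nodes t ->
  exists c : nat -> 'I_p.+1 -> R, forall k f, (k <= p)%N ->
    (size f <= p.+2)%N -> poly_node k f = \sum_i c k i * f.[tnth t i].
Proof.
move=> p0 tP; have tu := gauss_lobatto_uniq tP.
have [phi phiP] := unisolvent_dual_basis (lagrange_unisolvent tu).
exists (fun k i => poly_node k (phi i)) => k f kp sf.
pose g := \sum_i f.[tnth t i] *: phi i.
have sg : (size g <= p.+1)%N.
  rewrite (leq_trans (size_sum _ _ _))//; apply/bigmax_leqP => i _.
  by rewrite (leq_trans (size_scale_leq _ _)) ?(phiP i).1.
have rts : all (root (f - g)) t.
  apply/allP => _ /tnthP[i ->]; rewrite /root hornerD hornerN subr_eq0 eq_sym.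
  rewrite horner_sum (bigD1 i)//= hornerZ [(phi i).[_]]((phiP i).2 i) eqxx.
  rewrite mulr1 big1 ?addr0// => j ji.
  by rewrite hornerZ [(phi j).[_]]((phiP j).2 i) (negbTE ji) mulr0.
have [a fg] : exists a, f - g = a *: lobatto p.
  apply: (roots_proportional tu rts);
    rewrite ?size_tuple ?size_lobatto ?lobatto_neq0//.
    by case: tP => _ _ _ tN; apply/allP => x /tN[].
  by rewrite (leq_trans (size_polyD _ _))// size_polyN geq_max sf ltnW.
rewrite -[f in LHS](subrK g) fg linearP /= poly_node_lobatto// mulr0 add0r.
by rewrite linear_sum; apply: eq_bigr => i _; rewrite linearZ /= mulrC.
Qed.

(** Using the quadrature in each variable, a tensor functional is a combination
    of the values at the tensor nodes. *)
Lemma tensor_node_quadrature p (t : p.+1.-tuple R) w w' k l :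
  (0 < p)%N -> gauss_lobatto_nodes t -> Qpoly p.+1 w -> Qpoly p.+1 w' ->
  (forall i j, poly_fun w (tnth t i, tnth t j) =
               poly_fun w' (tnth t i, tnth t j)) ->
  (k <= p)%N -> (l <= p)%N ->
  tensor (poly_node k) (poly_node l) w = tensor (poly_node k) (poly_node l) w'.
Proof.
move=> p0 tP wQ wQ' ww' kp lp.
have [c cP] := gauss_lobatto_quadrature p0 tP.
have E u : Qpoly p.+1 u -> tensor (poly_node k) (poly_node l) u =
    \sum_i c k i * \sum_j c l j * poly_fun u (tnth t i, tnth t j).
  move=> [uX /sizeY_leqP uY]; rewrite /tensor cP ?(leq_trans (size_poly _ _))//.
  apply: eq_bigr => i _; congr (_ * _); rewrite horner_map_linear /= cP//.
  rewrite horner_coef (leq_trans (size_sum _ _ _))//; apply/bigmax_leqP => a _.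
  by rewrite -polyC_exp mulrC mul_polyC (leq_trans (size_scale_leq _ _)).
rewrite !E//; apply: eq_bigr => i _; congr (_ * _).
by apply: eq_bigr => j _; rewrite ww'.
Qed.

Lemma Qpoly_leq m n w : (m <= n)%N -> Qpoly m w -> Qpoly n w.
Proof.
move=> mn [wX wY].
by split; [apply: leq_trans wX _|apply: leq_trans wY _].
Qed.

End NodeFunctionals.

(** * Vertex-edge-cell data of functions on the square *)

Section Moments.
Local Open Scope classical_set_scope.
Context {R : realType}.
Implicit Types (f q : {poly R}) (w : {poly {poly R}}) (v g u : R * R -> R).
Notation mu := (@lebesgue_measure R).

(** Tensor products of the functionals, for functions; an iterated integral is
    used on the cell so that all the cases have the same form. *)
Definition moment k l v : R :=
  node_functional k (fun x => node_functional l (fun y => v (x, y))).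

Lemma moment_poly_fun k l w :
  moment k l (poly_fun w) = tensor (poly_node k) (poly_node l) w.
Proof.
rewrite /moment /tensor {2}/poly_node; congr node_functional.
by apply/funext => x; rewrite (horner_map_linear (poly_node l)).
Qed.

Lemma poly_fun_continuous_on_square w : continuous_on_square (poly_fun w).
Proof. by apply: continuous_subspaceT; exact: continuous_poly_fun. Qed.

Lemma continuous_on_squareM v u : continuous_on_square v ->
  continuous_on_square u -> continuous_on_square (fun z => v z * u z).
Proof. by move=> cv cu z; exact: cvgM (cv z) (cu z). Qed.

Lemma continuous_on_squareB v u : continuous_on_square v ->
  continuous_on_square u -> continuous_on_square (fun z => v z - u z).
Proof. by move=> cv cu z; exact: cvgB (cv z) (cu z). Qed.

Lemma segment_integrable (h : R -> R) : {within `[-1, 1], continuous h} ->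
  mu.-integrable `[-1, 1] (EFin \o h).
Proof. by apply: continuous_compact_integrable; exact: segment_compact. Qed.

Lemma segment_continuousM_poly (h : R -> R) q :
  {within `[-1, 1], continuous h} ->
  {within `[-1, 1], continuous (fun x => h x * q.[x])}.
Proof.
move=> ch; have cq : {within `[-1, 1], continuous (horner q)}.
  by apply: continuous_subspaceT; exact: continuous_horner.
by move=> x; exact: cvgM (ch x) (cq x).
Qed.

Lemma poly_fun_monomial q k z : poly_fun (q%:P * 'X^k) z = q.[z.2] * z.1 ^+ k.
Proof.
by rewrite /poly_fun hornerM hornerC hornerXn hornerM horner_exp hornerC.
Qed.

Lemma cell_momentE k l v : continuous_on_square v ->
  moment k.+2 l.+2 v =
  \int[(mu \x mu)%E]_(z in ref_square)
    (v z * poly_fun (('X^l)%:P * 'X^k) z).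
Proof.
move=> cv; rewrite fubini_square; last first.
  by apply: continuous_on_squareM => //; exact: poly_fun_continuous_on_square.
apply: eq_Rintegral => x; rewrite inE => xI /=; rewrite -RintegralZr//.
  by apply: eq_Rintegral => y _; rewrite poly_fun_monomial hornerXn mulrA.
rewrite (_ : _ \o _ = EFin \o (fun y => v (x, y) * ('X^l).[y])).
  apply: segment_integrable; apply: segment_continuousM_poly.
  exact: section_continuous.
by apply/funext => y /=; rewrite hornerXn.
Qed.

Lemma node_functionalB k (h1 h2 : R -> R) :
  {within `[-1, 1], continuous h1} -> {within `[-1, 1], continuous h2} ->
  node_functional k (fun x => h1 x - h2 x) =
  node_functional k h1 - node_functional k h2.
Proof.
move=> c1 c2; case: k => [|[|k]] //=.
have ik (h : R -> R) : {within `[-1, 1], continuous h} ->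
    mu.-integrable `[-1, 1] (EFin \o (fun x => h x * x ^+ k)).
  move=> ch; rewrite (_ : _ \o _ = EFin \o (fun x => h x * ('X^k).[x])).
    exact/segment_integrable/segment_continuousM_poly.
  by apply/funext => x /=; rewrite hornerXn.
rewrite -RintegralB//; [|exact: ik..].
by apply: eq_Rintegral => x _; rewrite mulrBl.
Qed.

Lemma endpoint_segment (c : R) : c \in [:: -1; 1] -> `[-1, 1] c.
Proof.
by rewrite !inE /= in_itv/= => /orP[] /eqP ->; rewrite lexx ltW ?gtrN.
Qed.

Lemma momentB k l v u : continuous_on_square v -> continuous_on_square u ->
  moment k l (fun z => v z - u z) = moment k l v - moment k l u.
Proof.
move=> cv cu.
have [I1 IN1] := (endpoint_segment (mem_last (-1) [:: 1]),
                 endpoint_segment (mem_head (-1) [:: 1])).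
case: k l => [|[|k]] [|[|l]];
  try by [|apply: node_functionalB; apply: section_continuous
          |apply: node_functionalB; apply: section_continuous_swap].
have cq (g : R * R -> R) : continuous_on_square g ->
    (mu \x mu)%E.-integrable ref_square
      (EFin \o (fun z => g z * poly_fun (('X^l)%:P * 'X^k) z)).
  move=> cg; apply: continuous_square_integrable.
  apply: continuous_on_squareM => //.
  exact: poly_fun_continuous_on_square.
rewrite !cell_momentE//; last exact: continuous_on_squareB.
rewrite -RintegralB; [|exact: ref_square_measurable|exact: cq|exact: cq].
by apply: eq_Rintegral => z _; rewrite mulrBl.
Qed.

Lemma edge_test (h : R -> R) n : {within `[-1, 1], continuous h} ->
  (forall k, (k < n)%N -> node_functional k.+2 h = 0) ->
  forall q, (size q <= n)%N -> \int[mu]_(x in `[-1, 1]) (h x * q.[x]) = 0.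
Proof.
move=> ch hk q.
have ih r : mu.-integrable `[-1, 1] (EFin \o (fun x => h x * r.[x])).
  exact/segment_integrable/segment_continuousM_poly.
apply: (@scalar_span0 _ (fun q => \int[mu]_(x in `[-1, 1]) (h x * q.[x]))).
  move=> a r s; rewrite -RintegralZl// -RintegralD//.
    by apply: eq_Rintegral => x _; rewrite hornerD hornerZ; ring.
  rewrite (_ : _ \o _ = EFin \o (fun x => h x * (a *: r).[x])) //.
  by apply/funext => x /=; rewrite hornerZ mulrCA.
move=> k kn; rewrite -[RHS](hk k kn).
by apply: eq_Rintegral => x _; rewrite hornerXn.
Qed.

(** A bivariate test polynomial is treated as a sum of c(y) x^k, and each c
    as a combination of powers of y. *)
Lemma cell_test g n : continuous_on_square g ->
  (forall k l, (k < n)%N -> (l < n)%N -> moment k.+2 l.+2 g = 0) ->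
  forall q : {poly {poly R}}, (size q <= n)%N -> (sizeY q <= n)%N ->
  \int[(mu \x mu)%E]_(z in ref_square) (g z * poly_fun q z) = 0.
Proof.
move=> cg gm q sX /sizeY_leqP sY.
pose Psi r := \int[(mu \x mu)%E]_(z in ref_square) (g z * poly_fun r z).
have ig r : (mu \x mu)%E.-integrable ref_square
      (EFin \o (fun z => g z * poly_fun r z)).
  apply: continuous_square_integrable; apply: continuous_on_squareM => //.
  exact: poly_fun_continuous_on_square.
have PsiD r s : Psi (r + s) = Psi r + Psi s.
  rewrite -RintegralD//; last exact: ref_square_measurable.
  by apply: eq_Rintegral => z _; rewrite /poly_fun !hornerD mulrDr.
have Psi0 : Psi 0 = 0.
  by apply/(@addrI _ (Psi 0)); rewrite -PsiD !addr0.
rewrite -/(Psi q) -[q]coefK poly_def.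
apply: (big_ind (fun r => Psi r = 0)) => //.
  by move=> r s r0 s0; rewrite PsiD r0 s0 addr0.
move=> k _; rewrite -mul_polyC.
have kn : (k < n)%N := leq_trans (ltn_ord k) sX.
apply: (@scalar_span0 _ (fun c => Psi (c%:P * 'X^k)) n); last exact: sY.
  move=> a r s; rewrite polyCD mulrDl PsiD -RintegralZl//.
  - congr (_ + _); apply: eq_Rintegral => z _.
    by rewrite !poly_fun_monomial hornerZ; ring.
  - exact: ref_square_measurable.
by move=> l ln; rewrite /= /Psi -cell_momentE ?gm.
Qed.

(** By linearity it suffices to test against monomials, and then the conditions
    say that the moments of w - v vanish.  Continuity of v makes the
    integrals of w and of v separately meaningful. *)
Lemma vec_interpolantP m v w : (2 <= m)%N -> continuous_on_square v ->
  vec_interpolant m v w <->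
  Qpoly m w /\ forall k l, (k <= m)%N -> (l <= m)%N ->
    tensor (poly_node k) (poly_node l) w = moment k l v.
Proof.
move=> m2 cv; have cw : continuous_on_square (poly_fun w).
  exact: poly_fun_continuous_on_square.
pose g z := poly_fun w z - v z.
have cg : continuous_on_square g by exact: continuous_on_squareB.
have momentE k l : moment k l g = 0 <->
    tensor (poly_node k) (poly_node l) w = moment k l v.
  rewrite momentB// moment_poly_fun; split=> [/eqP|->]; last exact: subrr.
  by rewrite subr_eq0 => /eqP.
have node c : c \in [:: -1; 1 : R] -> exists2 k : nat, (k < 2)%N &
    forall h, node_functional k h = h c.
  by rewrite !inE => /orP[] /eqP ->; [exists 0|exists 1%N].
have qX (k : nat) : (k.+2 <= m)%N -> Ppoly (m - 2) ('X^k : {poly R}).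
  by move=> km; rewrite /Ppoly /= size_polyXn; lia.
have qXY k l : (k.+2 <= m)%N -> (l.+2 <= m)%N ->
    Qpoly (m - 2) (('X^l : {poly R})%:P * 'X^k).
  move=> km lm; rewrite mul_polyC; split.
    by rewrite (leq_trans (size_scale_leq _ _))// size_polyXn; lia.
  apply/sizeY_leqP => i; rewrite coefZ coefXn mulr_natr.
  case: (i == k); last by rewrite mulr0n size_poly0.
  by rewrite mulr1n size_polyXn; lia.
split=> [[wQ wV wE wC]|[wQ wm]]; split=> //.
- move=> k l km lm; apply/momentE; case: k l km lm => [|[|k]] [|[|l]] km lm.
  all: try by apply: wV; rewrite !inE eqxx ?orbT.
  + have [_ E] := wE (-1) (mem_head _ _) _ (qX l lm).
    by rewrite -[RHS]E; apply: eq_Rintegral => x _; rewrite hornerXn.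
  + have [_ E] := wE 1 (mem_last _ [:: 1]) _ (qX l lm).
    by rewrite -[RHS]E; apply: eq_Rintegral => x _; rewrite hornerXn.
  + have [E _] := wE (-1) (mem_head _ _) _ (qX k km).
    by rewrite -[RHS]E; apply: eq_Rintegral => x _; rewrite hornerXn.
  + have [E _] := wE 1 (mem_last _ [:: 1]) _ (qX k km).
    by rewrite -[RHS]E; apply: eq_Rintegral => x _; rewrite hornerXn.
  + rewrite cell_momentE//; apply: wC; exact: qXY.
- move=> a b /node[k k2 ka] /node[l l2 lb].
  have km := leq_trans (ltnW k2) m2; have lm := leq_trans (ltnW l2) m2.
  have := (momentE k l).2 (wm k l km lm).
  by rewrite /moment ka lb.
- move=> c cc; have [k k2 kc] := node c cc; have km := leq_trans (ltnW k2) m2.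
  move=> q qP; split; apply: (edge_test _ _ qP); rewrite -/g.
  + exact: (section_continuous_swap cg (endpoint_segment cc)).
  + move=> l lm; have /momentE := wm l.+2 k ltac:(lia) km.
    by rewrite /moment; under [X in node_functional _ X]funext do rewrite kc.
  + exact: (section_continuous cg (endpoint_segment cc)).
  + move=> l lm; have /momentE := wm k l.+2 km ltac:(lia).
    by rewrite /moment kc.
- move=> q [sX sY]; apply: (cell_test cg _ sX sY) => k l km lm.
  by apply/momentE/wm; lia.
Qed.

End Moments.

(** * The interpolation operators *)

Section VecInterpolation.
Context {R : realType}.
Implicit Types (w : {poly {poly R}}) (v : R * R -> R).

Lemma vec_interpP m v : (2 <= m)%N -> continuous_on_square v ->
  vec_interpolant m v (vec_interp m v).
Proof.
move=> m2 cv; apply: xgetPex.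
have [w [wQ wm]] := tensor_exists (fun k l => moment k l v)
  (@poly_node_unisolvent R m (ltnW m2)).
exists w; apply/vec_interpolantP => //; split=> // k l km lm.
exact: (wm (Ordinal (km : (k < m.+1)%N)) (Ordinal (lm : (l < m.+1)%N))).
Qed.

Lemma vec_interpolant_unique m v w w' : (2 <= m)%N -> continuous_on_square v ->
  vec_interpolant m v w -> vec_interpolant m v w' -> w = w'.
Proof.
move=> m2 cv /(vec_interpolantP _ m2 cv)[wQ wm].
move=> /(vec_interpolantP _ m2 cv)[wQ' wm'].
pose L (i : 'I_m.+1) : {scalar {poly R}} := poly_node i.
have ww' i j : tensor (L i) (L j) w = tensor (L i) (L j) w'.
  exact: etrans (wm i j (leq_ord i) (leq_ord j))
                (esym (wm' i j (leq_ord i) (leq_ord j))).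
exact: (@tensor_unique R m L w w' (poly_node_unisolvent (ltnW m2))).
Qed.

End VecInterpolation.

Theorem lemma3p3 (R : realType) (p : nat) (t : p.+1.-tuple R) :
  (2 <= p)%N ->
  gauss_lobatto_nodes t ->
  (forall v : R * R -> R, continuous_on_square v ->
     vec_interp p v = lagrange_interp t (poly_fun (vec_interp p.+1 v))) /\
  (forall s : R, -1 < s < 1 -> s \notin t ->
   forall v : R * R -> R, continuous_on_square v ->
     lagrange_interp t v =
     vec_interp p (poly_fun (lagrange_interp (rcons_tuple t s) v))).
Proof.
move=> p2 tP; have tu := gauss_lobatto_uniq tP; have p0 := ltnW p2.
split=> [v cv|s _ st v _].
- set w := vec_interp p.+1 v; set u := lagrange_interp t _.
  have /(vec_interpolantP _ (leqW p2) cv)[wQ wm] : vec_interpolant p.+1 v w.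
    exact: vec_interpP (leqW p2) cv.
  have [uQ uw] : lagrange_interpolant t (poly_fun w) u.
    exact: lagrange_interpP.
  apply: (vec_interpolant_unique p2 cv (vec_interpP p2 cv)).
  apply/(vec_interpolantP _ p2 cv); split=> // k l kp lp.
  rewrite -(wm k l (leqW kp) (leqW lp)).
  by apply: (tensor_node_quadrature p0 tP) => //; apply: Qpoly_leq uQ.
- set u := lagrange_interp t v; set w := lagrange_interp _ v.
  have [uQ uv] : lagrange_interpolant t v u by exact: lagrange_interpP.
  have [wQ wv] : lagrange_interpolant (rcons_tuple t s) v w.
    by apply: lagrange_interpP; rewrite rcons_uniq st.
  have cw : continuous_on_square (poly_fun w).
    exact: poly_fun_continuous_on_square.
  apply: (vec_interpolant_unique p2 cw) (vec_interpP p2 cw).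
  apply/(vec_interpolantP _ p2 cw); split=> // k l kp lp.
  rewrite moment_poly_fun; apply: (tensor_node_quadrature p0 tP) => //.
    exact: Qpoly_leq uQ.
  have tE (i : 'I_p.+1) :
      tnth t i = tnth (rcons_tuple t s) (widen_ord (leqnSn _) i).
    by rewrite !(tnth_nth 0) /= nth_rcons size_tuple ltn_ord.
  by move=> i j; rewrite uv !tE wv.
Qed.
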